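(* Let $T$ be a homogeneous tree of degree $q\ge 1$. For $v\in V$ and $\omega\in\Omega$ let $v_+$ be the neighbour of $v$ that is closer to $\omega$, and put $e(v,\omega)=[v,v_+]\in E$. Then for each $\omega\in\Omega$ the map $\xi_\omega:V\to E$, $v\mapsto e(v,\omega)$, is an injection (whose inverse associates to an edge its endpoint farther from $\omega$), and it induces a bijection from the vertex-horospheres tangent at $\omega$ onto the edge-horospheres tangent at $\omega$. Letting $\omega$ vary in $\Omega$, one obtains a bijection $\Xi:\mathcal H_V\to\mathcal H_E$ that is equivariant under $\operatorname{Aut}T$, i.e. $\Xi(\lambda\mathbf h)=\lambda\,\Xi(\mathbf h)$ for all $\lambda\in\operatorname{Aut}T$, $\mathbf h\in\mathcal H_V$. Moreover $\Xi$ is an isomorphism of fiber bundles.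
   Context: $T$ is a tree in which every vertex has exactly $q+1$ neighbours; $V$, $E$ are its sets of vertices and (unoriented) edges, $\operatorname{dist}$ is the graph distance on $V$, $\operatorname{Aut}T$ its automorphism group. $\Omega$ is the set of ends: equivalence classes of geodesic rays, two rays being equivalent if they eventually coincide; $[v,\omega)$ is the unique ray starting at $v$ in the class $\omega$. The topology of $\Omega$ is generated by the arcs $\Omega(u,v)=\{\omega: v\in[u,\omega)\}$, $u\ne v$. ''The neighbour of $v$ closer to $\omega$'' is the second vertex of $[v,\omega)$. Vertex-horospherical index: $h(v,v_0,\omega)=\operatorname{dist}(v_0,w)-\operatorname{dist}(v,w)$ for any $w$ far enough along $[v_0,\omega)$. Edge-horospherical index: $h(e,e_0,\omega)=h(v(e,\omega),v(e_0,\omega),\omega)$, where $v(e,\omega)$ is the endpoint of $e$ closer to $\omega$. A vertex-horosphere (edge-horosphere) tangent at $\omega$ is a level set of $v\mapsto h(v,v_0,\omega)$ (of $e\mapsto h(e,e_0,\omega)$); this does not depend on $v_0$ (on $e_0$). $\mathcal H_V$ (resp. $\mathcal H_E$) is the set of all vertex- (resp. edge-) horospheres, each considered together with its tangency point. It is a trivial principal bundle with base $\Omega$ (the projection $\pi$ sends a horosphere to its tangency point) and structure group $\mathbb Z$: a choice of $v_0$ (resp. $e_0$) gives a global chart $\mathcal H\cong\Omega\times\mathbb Z$, $\mathbf h\mapsto(\omega,n)$ with $n$ the index of $\mathbf h$; the topology is the product topology (independent of the choice of reference element) and $k\in\mathbb Z$ acts by $(\omega,n)\mapsto(\omega,n+k)$.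 A bundle isomorphism is a homeomorphism that commutes with the $\mathbb Z$-actions and covers a homeomorphism of the bases. $\operatorname{Aut}T$ acts on horospheres by its action on vertices/edges and on $\Omega$. *)

(* Defs.v *)
From HB Require Import structures.
From mathcomp Require Import all_boot all_order all_algebra.
From mathcomp Require Import all_classical topology.
From mathcomp Require Import zify.

Set Implicit Arguments.
Unset Strict Implicit.
Unset Printing Implicit Defensive.

Import Order.TTheory GRing.Theory Num.Theory.

Local Open Scope classical_set_scope.

Record tree := Tree {
  vertex :> choiceType;
  adj : rel vertex;
  adj_sym : symmetric adj;
  adj_irr : irreflexive adj;
  tree_connected : forall x y, exists2 p, path adj x p & last x p = y;
  tree_acyclic : forall c : seq vertex, ucycle adj c -> size c <= 2
}.

Definition homogeneous (q : nat) (T : tree) :=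
  forall v : T, ([set w | adj v w] #= `I_q.+1)%card.

Section Distance.
Variable T : tree.
Implicit Types x y z : T.

Definition walk_of_length x y n :=
  exists p, [/\ path (@adj T) x p, last x p = y & size p = n].

Lemma ex_walk x y : exists n, `[< walk_of_length x y n >].
Proof.
have [p xp py] := tree_connected x y.
by exists (size p); apply/asboolP; exists p.
Qed.

Definition dist x y : nat := ex_minn (ex_walk x y).

Lemma dist_walk x y : walk_of_length x y (dist x y).
Proof. by rewrite /dist; case: ex_minnP => n /asboolP. Qed.

Lemma dist_le x p : path (@adj T) x p -> dist x (last x p) <= size p.
Proof.
move=> xp; rewrite /dist; case: ex_minnP => n _; apply.
by apply/asboolP; exists p.
Qed.

Lemma distxx x : dist x x = 0.
Proof. by apply/eqP; rewrite -leqn0; apply: (@dist_le x [::]). Qed.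

Lemma dist_eq0 x y : dist x y = 0 -> x = y.
Proof.
by have [p [_ <-]] := dist_walk x y; move=> <- /eqP; rewrite size_eq0 => /eqP->.
Qed.

Lemma dist_tri y x z : dist x z <= dist x y + dist y z.
Proof.
have [p [xp py <-]] := dist_walk x y; have [p' [yp pz <-]] := dist_walk y z.
rewrite -size_cat -pz -py -last_cat; apply: dist_le.
by rewrite cat_path xp py.
Qed.

Lemma adj_dist x y : adj x y -> dist x y = 1.
Proof.
move=> xy; apply/eqP; rewrite eqn_leq; apply/andP; split.
  by apply: (@dist_le x [:: y]); rewrite /= xy.
by rewrite lt0n; apply/eqP => /dist_eq0 xyE; move: xy; rewrite xyE adj_irr.
Qed.

Lemma dist1_adj x y : dist x y = 1 -> adj x y.
Proof.
move=> d1; have := dist_walk x y; rewrite d1 => -[[|z [|z' p]] [] //=].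
by rewrite andbT => xz <-.
Qed.

Lemma dist_le_sym x y : dist y x <= dist x y.
Proof.
have [p [xp <- <-]] := dist_walk x y.
have -> : x = last (last x p) (rev (belast x p)).
  by case: (p) => //= z p'; rewrite rev_cons last_rcons.
rewrite -[leqRHS](size_belast x) -size_rev; set z := last _ (rev _).
have -> : last z p = last x p by case: (p) @z.
apply: dist_le; rewrite rev_path; apply: sub_path xp => u v.
by rewrite adj_sym.
Qed.

Lemma dist_sym x y : dist x y = dist y x.
Proof. by apply/eqP; rewrite eqn_leq !dist_le_sym. Qed.

Lemma acyclic_fork x s t :
    path (@adj T) x s -> path (@adj T) x t -> uniq (x :: s) -> uniq (x :: t) ->
  has (mem t) s -> head x s = head x t.
Proof.
move=> + + + + hasp; case/split_find: hasp => z s1 s2 /= zt ns.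
case/splitPr: zt ns => s3 s4 ns.
rewrite cat_path => /andP[xs1 _]; rewrite -cat_rcons cat_path => /andP[xs3 _].
rewrite mem_cat negb_or => /andP[/andP[xs1N _]].
rewrite (cat_uniq (rcons s1 z)) => /and3P[us1 _ _].
rewrite mem_cat negb_or => /andP[/andP[xs3N _]].
rewrite cat_uniq => /and3P[us3 _ _].
have cyc : ucycle (@adj T) (x :: rcons s1 z ++ rev s3).
  rewrite /ucycle /=; apply/andP; split.
    rewrite rcons_cat cat_path xs1 last_rcons -rev_cons.
    have -> : x :: s3 = belast x (rcons s3 z) by rewrite belast_rcons.
    rewrite -{1}(last_rcons x s3 z) rev_path; apply: sub_path xs3 => u v.
    by rewrite adj_sym.
  rewrite mem_cat mem_rev negb_or xs1N.
  move: xs3N; rewrite mem_rcons in_cons negb_or => /andP[_ ->] /=.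
  rewrite cat_uniq us1 rev_uniq; move: us3; rewrite rcons_uniq => /andP[zs3 ->].
  rewrite andbT; apply/hasPn => w; rewrite mem_rev => ws3.
  apply/negP => /=; rewrite mem_rcons in_cons => /orP[/eqP wz|ws1].
    by move: zs3; rewrite -wz ws3.
  by move/hasPn: ns => /(_ w ws1) /=; rewrite mem_cat ws3.
have := tree_acyclic cyc; rewrite /= size_cat size_rcons size_rev.
by case: (s1) => [|? ?]; case: (s3) => [|? ?] //=; rewrite ?addnS.
Qed.

Lemma simple_path_unique x p p' :
    path (@adj T) x p -> path (@adj T) x p' -> uniq (x :: p) -> uniq (x :: p') ->
  last x p = last x p' -> p = p'.
Proof.
elim: p x p' => [|a p IH] x [|b p'] //.
- by move=> _ _ _ /andP[/negP + _] /= xE; case; rewrite xE mem_last.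
- by move=> _ _ /andP[/negP + _] _ /= xE; case; rewrite -xE mem_last.
move=> xp xp' up up' pp'; have ab : a = b.
  apply: (acyclic_fork xp xp' up up'); apply/hasP.
  exists (last a p); first exact: mem_last.
  by rewrite (pp' : last a p = last b p'); exact: mem_last.
rewrite -{b}ab in xp' up' pp' *; congr (_ :: _).
by move: xp xp' up up' => /andP[_ ?] /andP[_ ?] /andP[_ ?] /andP[_ ?]; apply: (IH a).
Qed.

Lemma simple_path_dist x p :
  path (@adj T) x p -> uniq (x :: p) -> dist x (last x p) = size p.
Proof.
move=> xp up; have [p' [xp' p'E p'd]] := dist_walk x (last x p).
move: p'E p'd; case: (shortenP xp') => s xs us ss sE sd.
have sp : s = p by apply: (@simple_path_unique x).
apply/eqP; rewrite eqn_leq dist_le //= -sd -sp.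
move: us => /andP[_ us]; exact: uniq_leq_size.
Qed.

Lemma adj_dist_neq x y z : adj x y -> dist x z != dist y z.
Proof.
wlog: x y / dist x z <= dist y z.
  by move=> H xy; case: (leqP (dist x z) (dist y z)) => [/H|/ltnW/H];
    [exact|rewrite eq_sym adj_sym; apply].
move=> xyz xy; have [p [yp pz pd]] := dist_walk y z.
move: pz pd; case: (shortenP yp) => s ys us ss sz sd.
have sE : size s = dist y z.
  by rewrite -(simple_path_dist ys us) sz.
have [/[dup] xs|xs] := boolP (x \in y :: s).
  rewrite in_cons => /orP[/eqP xE|]; first by move: xy; rewrite xE adj_irr.
  move=> {}xs; case/splitPr: xs ys us sz sE => s1 s2.
  rewrite cat_path /= => /and3P[_ _ xs2] _; rewrite last_cat /= => <- <-.
  rewrite ltn_eqF// (leq_ltn_trans (dist_le xs2))// size_cat /=.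
  by rewrite addnS ltnS leq_addl.
have xs' : path (@adj T) x (y :: s) by rewrite /= xy.
have uxs : uniq (x :: y :: s) by rewrite cons_uniq xs us.
by have := simple_path_dist xs' uxs; rewrite /= sz => ->; rewrite sE neq_ltn ltnSn orbT.
Qed.

End Distance.

Section Ends.
Variable T : tree.

Definition geodesic_ray (r : nat -> T) :=
  forall i j, i <= j -> dist (r i) (r j) = j - i.

Definition ray_equiv (r s : nat -> T) :=
  exists m n, forall k, r (m + k) = s (n + k).

Lemma ray_equiv_sym r s : ray_equiv r s -> ray_equiv s r.
Proof. by move=> [m [n rs]]; exists n, m => k; rewrite rs. Qed.

Lemma ray_equiv_trans r s t : ray_equiv r s -> ray_equiv s t -> ray_equiv r t.
Proof.
move=> [m [n rs]] [m' [n' st]]; exists (m + m'), (n + n') => k.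
by rewrite -addnA rs addnCA st addnA [n' + n]addnC.
Qed.

Record tree_end := TreeEnd {
  end_rays :> (nat -> T) -> Prop;
  end_rays_class : exists2 r, geodesic_ray r &
    end_rays = [set s | geodesic_ray s /\ ray_equiv r s]
}.

Lemma tree_end_eq (w w' : tree_end) : end_rays w = end_rays w' -> w = w'.
Proof.
case: w w' => [A p] [B p'] /= AB; rewrite -AB in p' *.
by rewrite (Prop_irrelevance p p').
Qed.

Lemma end_ex (w : tree_end) : exists r, w r.
Proof.
by have [r rr ->] := end_rays_class w; exists r; split => //; exists 0, 0.
Qed.

Lemma end_ray (w : tree_end) r : w r -> geodesic_ray r.
Proof. by have [s ss ->] := end_rays_class w; case. Qed.

Lemma end_equiv (w : tree_end) r s : w r -> w s -> ray_equiv r s.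
Proof.
have [t tt ->] := end_rays_class w; move=> [_ /ray_equiv_sym tr] [_ ts].
exact: ray_equiv_trans ts.
Qed.

Lemma end_mem (w : tree_end) r s :
  w r -> geodesic_ray s -> ray_equiv r s -> w s.
Proof.
have [t tt ->] := end_rays_class w; move=> [_ tr] ss rs; split => //.
exact: ray_equiv_trans rs.
Qed.

Lemma ray_adj r i : geodesic_ray r -> adj (r i) (r i.+1).
Proof. by move=> rr; apply: dist1_adj; rewrite rr // subSnn. Qed.

Lemma adj_seq_dist (r : nat -> T) i j :
  (forall i, adj (r i) (r i.+1)) -> i <= j -> dist (r i) (r j) <= j - i.
Proof.
move=> ra; elim: j => [|j IH]; first by rewrite leqn0 => /eqP->; rewrite distxx.
rewrite leq_eqVlt => /orP[/eqP->|]; first by rewrite distxx.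
rewrite ltnS => ij; rewrite subSn //.
apply: leq_trans (dist_tri (r j) _ _) _.
by rewrite (adj_dist (ra j)) addn1 ltnS IH.
Qed.

Lemma adj_seq_ray (r : nat -> T) d : (forall i, adj (r i) (r i.+1)) ->
  (forall j, d <= j -> dist (r 0) (r j) = j) -> geodesic_ray r.
Proof.
move=> ra rd i j ij; apply/eqP; rewrite eqn_leq adj_seq_dist //=.
have dJ := rd (maxn j d) (leq_maxr _ _).
have t1 := dist_tri (r i) (r 0) (r (maxn j d)).
have t2 := dist_tri (r j) (r i) (r (maxn j d)).
have b1 := adj_seq_dist ra (leq0n i).
have b2 := adj_seq_dist ra (leq_maxl j d).
lia.
Qed.

Lemma ray_prefix (r : nat -> T) m : geodesic_ray r ->
  [/\ path (@adj T) (r 0) (map r (iota 1 m)),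
      uniq (r 0 :: map r (iota 1 m)) & last (r 0) (map r (iota 1 m)) = r m].
Proof.
move=> rr; split.
- elim: m => // m IH; rewrite -[m.+1]addn1 iotaD map_cat cat_path IH /= andbT.
  rewrite last_map; have -> : last 0 (iota 1 m) = m.
    by rewrite (last_nth 0) size_iota (@nth_iota 0 0 m.+1).
  by rewrite add1n ray_adj.
- rewrite -[r 0 :: _]/(map r (iota 0 m.+1)) map_inj_uniq ?iota_uniq // => i j.
  wlog ij : i j / i <= j => [H|].
    by case: (leqP i j) => [/H|/ltnW/H HH rij]; [|rewrite HH].
  by move=> rij; have := rr _ _ ij; rewrite rij distxx; lia.
- rewrite last_map; congr r.
  by rewrite (last_nth 0) size_iota (@nth_iota 0 0 m.+1).
Qed.

Lemma ray_unique r s : geodesic_ray r -> geodesic_ray s -> r 0 = s 0 ->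
  ray_equiv r s -> r = s.
Proof.
move=> rr ss r0 [m [n rs]]; have mn : m = n.
  have := rr 0 (m + 0) (leq0n _); rewrite r0 rs ss //; lia.
rewrite -{n}mn in rs; apply/funext => j.
have [pr ur lr] := ray_prefix (m + j) rr.
have [ps us ls] := ray_prefix (m + j) ss.
rewrite -r0 in ps us ls; have E : map r (iota 1 (m + j)) = map s (iota 1 (m + j)).
  by apply: (@simple_path_unique _ (r 0)) => //; rewrite lr ls.
case: j E {pr ur lr ps us ls} => [//|j] E.
have := congr1 (nth (r 0) ^~ j) E.
by rewrite !(nth_map 0) ?size_iota ?addnS ?ltnS ?leq_addl// nth_iota ?add1n// ltnS leq_addl.
Qed.

Lemma ray_stable v r : geodesic_ray r ->
  exists N, forall j, dist v (r (N + j)) = dist v (r N) + j.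
Proof.
move=> rr; pose D k := dist (r 0) v + dist v (r k) - k.
have Dge k : k <= dist (r 0) v + dist v (r k).
  by rewrite -[leqLHS](subn0 k) -rr // dist_tri.
have Dex : exists n, `[< exists k, D k = n >].
  by exists (D 0); apply/asboolP; exists 0.
have [n /asboolP[N DN] nmin] := ex_minnP Dex.
exists N => j; have : n <= D (N + j) by apply: nmin; apply/asboolP; exists (N + j).
rewrite -DN /D => H; have := Dge N; have := Dge (N + j).
have := dist_tri (r N) v (r (N + j)).
rewrite (rr N (N + j)) ?leq_addr//; lia.
Qed.

Lemma ray_from_ex v (w : tree_end) : exists r, w r /\ r 0 = v.
Proof.
have [r wr] := end_ex w; have rr := end_ray wr.
have [N rN] := ray_stable v rr.
have [p [vp pN pd]] := dist_walk v (r N).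
set d := dist v (r N) in rN pd.
pose s i := if i <= d then nth v (v :: p) i else r (N + (i - d)).
have sd k : s (d + k) = r (N + k).
  rewrite /s; case: k => [|k]; last by rewrite -{2}(addn0 d) leq_add2l addKn.
  by rewrite !addn0 leqnn -pd -last_nth.
have s0 : s 0 = v by [].
have sa i : adj (s i) (s i.+1).
  case: (ltnP i d) => id; last first.
    by rewrite -(subnKC id) -addnS !sd addnS ray_adj.
  by rewrite /s (ltnW id) id; apply: (pathP v vp); rewrite pd.
exists s; split => //; apply: (end_mem wr); last by exists N, d => k; rewrite sd.
apply: (@adj_seq_ray s d) => // j dj.
by rewrite s0 -(subnKC dj) sd rN.
Qed.

Definition ray_from (v : T) (w : tree_end) : nat -> T := sval (cid (ray_from_ex v w)).

Lemma ray_from_in v (w : tree_end) : w (ray_from v w).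
Proof. by rewrite /ray_from; case: cid => r []. Qed.

Lemma ray_from0 v w : ray_from v w 0 = v.
Proof. by rewrite /ray_from; case: cid => r []. Qed.

Lemma ray_from_unique v (w : tree_end) r : w r -> r 0 = v -> r = ray_from v w.
Proof.
move=> wr r0; have ws := ray_from_in v w.
apply: ray_unique; rewrite ?ray_from0 //; first exact: end_ray wr.
- exact: end_ray ws.
- exact: end_equiv wr ws.
Qed.

Definition end_arc (u v : T) : set tree_end := [set w | range (ray_from u w) v].

Definition far_along (v : T) (w : tree_end) (P : T -> Prop) :=
  exists N, forall k, N <= k -> P (ray_from v w k).

Lemma far_alongP v (w : tree_end) (P : T -> Prop) r : w r ->
  (exists N, forall k, N <= k -> P (r k)) <-> far_along v w P.
Proof.
have E (s t : nat -> T) : ray_equiv s t ->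
    (exists N, forall k, N <= k -> P (s k)) ->
    exists N, forall k, N <= k -> P (t k).
  move=> [m [n st]] [N sP]; exists (n + N) => k nNk.
  by rewrite -(subnKC (leq_trans (leq_addr _ _) nNk)) -st; apply: sP; lia.
move=> wr; have ws := ray_from_in v w.
by split; apply: E; [exact: end_equiv wr ws|exact: end_equiv ws wr].
Qed.

(* v_+ *)
Definition next_vertex (v : T) (w : tree_end) : T := ray_from v w 1.

Lemma next_vertex_adj v w : adj v (next_vertex v w).
Proof.
by rewrite -{1}(ray_from0 v w); apply: ray_adj; apply: end_ray (ray_from_in v w).
Qed.

End Ends.

HB.instance Definition _ (T : tree) := gen_eqMixin (tree_end T).
HB.instance Definition _ (T : tree) := gen_choiceMixin (tree_end T).
HB.instance Definition _ (T : tree) :=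
  @isSubBaseTopological.Build (tree_end T) (set (tree_end T))
    [set A | exists u v : T, u <> v /\ A = end_arc u v] id.

Section Edges.
Variable T : tree.

Record edge := Edge {
  endpoints :> T -> Prop;
  edge_adj : exists u v, adj u v /\ endpoints = [set u; v]
}.

Lemma edge_eq (e e' : edge) : endpoints e = endpoints e' -> e = e'.
Proof.
case: e e' => [A p] [B p'] /= AB; rewrite -AB in p' *.
by rewrite (Prop_irrelevance p p').
Qed.

Definition closer (w : tree_end T) (u v : T) :=
  far_along u w (fun x => dist u x < dist v x).

Lemma closer_asym (w : tree_end T) u v : closer w u v -> closer w v u -> False.
Proof.
rewrite /closer => uv /(far_alongP u _ (ray_from_in v w)) [N vu].
case: uv => N' uv; have := vu (maxn N N') (leq_maxl _ _).
by have := uv (maxn N N') (leq_maxr _ _); lia.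
Qed.

Lemma adj_closer w u v : adj u v -> closer w u v \/ closer w v u.
Proof.
move=> auv; have [r wr] := end_ex w; have rr := end_ray wr.
have [N uN] := ray_stable u rr; have [M vM] := ray_stable v rr.
have uv := adj_dist_neq (r (maxn N M)) auv.
have E k : maxn N M <= k ->
    dist u (r k) = dist u (r (maxn N M)) + (k - maxn N M) /\
    dist v (r k) = dist v (r (maxn N M)) + (k - maxn N M).
  move=> le; have := uN (k - N); have := vM (k - M).
  have := uN (maxn N M - N); have := vM (maxn N M - M).
  rewrite !subnKC ?leq_maxl ?leq_maxr//; lia.
case: (ltngtP (dist u (r (maxn N M))) (dist v (r (maxn N M)))) uv => // lt _.
- left; apply/(far_alongP u _ wr); exists (maxn N M) => k /E[-> ->].
  by rewrite ltn_add2r.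
- right; apply/(far_alongP v _ wr); exists (maxn N M) => k /E[-> ->].
  by rewrite ltn_add2r.
Qed.

Definition is_near (e : edge) (w : tree_end T) (u : T) :=
  e u /\ forall v, e v -> v <> u -> closer w u v.

Definition is_far (e : edge) (w : tree_end T) (u : T) :=
  e u /\ forall v, e v -> v <> u -> closer w v u.

Lemma near_far_ex e w : (exists u, is_near e w u) /\ (exists u, is_far e w u).
Proof.
have [u [v [auv eE]]] := edge_adj e; rewrite /is_near /is_far eE.
have [uv|vu] := adj_closer w auv; split.
- by exists u; split => [|x [] ->]; [left| |].
- by exists v; split => [|x [] ->]; [right| |].
- by exists v; split => [|x [] ->]; [right| |].
- by exists u; split => [|x [] ->]; [left| |].
Qed.

Definition near_end e w : T := sval (cid (near_far_ex e w).1).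
Definition far_end e w : T := sval (cid (near_far_ex e w).2).

Lemma near_endP e w : is_near e w (near_end e w).
Proof. by rewrite /near_end; case: cid. Qed.

Lemma far_endP e w : is_far e w (far_end e w).
Proof. by rewrite /far_end; case: cid. Qed.

Lemma is_near_unique e w u : is_near e w u -> u = near_end e w.
Proof.
move=> [eu nu]; have [ev nv] := near_endP e w.
apply: contrapT => uv; apply: (@closer_asym w u (near_end e w)).
- by apply: nu => // /esym.
- exact: nv.
Qed.

(* xi_omega *)
Definition edge_toward (w : tree_end T) (v : T) : edge :=
  @Edge [set v; next_vertex v w]
    (ex_intro _ v (ex_intro _ (next_vertex v w) (conj (next_vertex_adj v w) erefl))).

End Edges.

Section HorosphericalIndex.
Variable T : tree.
Local Open Scope ring_scope.

Definition is_vertex_index (v v0 : T) (w : tree_end T) (n : int) :=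
  far_along v0 w (fun x => n = (dist v0 x)%:Z - (dist v x)%:Z).

Lemma vertex_index_ex v v0 w : exists n, is_vertex_index v v0 w n.
Proof.
have wr := ray_from_in v0 w; have rr := end_ray wr.
have [N uN] := ray_stable v0 rr; have [M vM] := ray_stable v rr.
pose K := maxn N M; set r := ray_from v0 w in rr uN vM.
exists ((dist v0 (r K))%:Z - (dist v (r K))%:Z); exists K => k le.
rewrite -/r; have := uN (k - N)%N; have := vM (k - M)%N.
have := uN (K - N)%N; have := vM (K - M)%N; rewrite /K in le *.
rewrite !subnKC ?leq_maxl ?leq_maxr//; lia.
Qed.

Definition vertex_index v v0 w : int := sval (cid (vertex_index_ex v v0 w)).

Lemma vertex_indexP v v0 w : is_vertex_index v v0 w (vertex_index v v0 w).
Proof. by rewrite /vertex_index; case: cid. Qed.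

Lemma is_vertex_index_unique v v0 w n :
  is_vertex_index v v0 w n -> n = vertex_index v v0 w.
Proof.
move=> [N nP]; have [M mP] := vertex_indexP v v0 w.
by rewrite (nP (maxn N M)) ?leq_maxl// [RHS](mP (maxn N M)) ?leq_maxr.
Qed.

Definition edge_index (e e0 : edge T) (w : tree_end T) : int :=
  vertex_index (near_end e w) (near_end e0 w) w.

End HorosphericalIndex.

(* Horospheres of both kinds: [X] is the set of vertices or of edges and [h]   *)
(* the corresponding horospherical index.                                     *)
Section Horospheres.
Variables (T : tree) (X : Type) (h : X -> X -> tree_end T -> int).
Local Open Scope ring_scope.

Definition horo_level (x0 : X) (w : tree_end T) (n : int) : set X :=
  [set x | h x x0 w = n].

Definition tangent_horospheres (w : tree_end T) : set (set X) :=
  [set A | exists x0 n, A = horo_level x0 w n].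

Record horosphere := Horosphere {
  tangency : tree_end T;
  horo_points : set X;
  horo_tangent : tangent_horospheres tangency horo_points
}.

Lemma horosphere_eq (H K : horosphere) :
  tangency H = tangency K -> horo_points H = horo_points K -> H = K.
Proof.
case: H K => [w A p] [w' B p'] /= ww AB.
by subst; rewrite (Prop_irrelevance p p').
Qed.

(* The [n] with [horo_points H = horo_level x0 (tangency H) n]: it exists by   *)
(* the cocycle identity of [h], and is unique in a homogeneous tree of degree  *)
(* q >= 1, where no level is empty.                                           *)
Definition horo_index (x0 : X) (H : horosphere) : int :=
  xget 0 [set n | horo_points H = horo_level x0 (tangency H) n].

Definition horo_chart (x0 : X) (H : horosphere) :
  tree_end T * discrete_topology int := (tangency H, horo_index x0 H).

Definition horo_of_index (x0 : X) (w : tree_end T) (n : int) : horosphere :=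
  @Horosphere w (horo_level x0 w n) (ex_intro _ x0 (ex_intro _ n erefl)).

Definition horo_shift (x0 : X) (k : int) (H : horosphere) : horosphere :=
  horo_of_index x0 (tangency H) (horo_index x0 H + k).

End Horospheres.

HB.instance Definition _ T X h := gen_eqMixin (@horosphere T X h).
HB.instance Definition _ T X h := gen_choiceMixin (@horosphere T X h).

(* The bundle space with the product topology read in the chart at [x0]. *)
Definition horo_space (T : tree) (X : Type) (h : X -> X -> tree_end T -> int)
    (x0 : X) : topologicalType :=
  initial_topology (@horo_chart T X h x0).

Definition vertex_horosphere (T : tree) := horosphere (@vertex_index T).
Definition edge_horosphere (T : tree) := horosphere (@edge_index T).

Record tree_aut (T : tree) := TreeAut {
  aut_fun :> T -> T;
  aut_bij : bijective aut_fun;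
  aut_adj : forall x y, adj (aut_fun x) (aut_fun y) = adj x y
}.

Section AutAction.
Variables (T : tree) (g : tree_aut T).

Lemma aut_dist_le (f : T -> T) x y :
  (forall x y, adj (f x) (f y) = adj x y) -> dist (f x) (f y) <= dist x y.
Proof.
move=> fa; have [p [xp <- <-]] := dist_walk x y.
rewrite -last_map -(size_map f); apply: dist_le.
by rewrite path_map; apply: sub_path xp => u v /=; rewrite fa.
Qed.

Lemma aut_dist x y : dist (g x) (g y) = dist x y.
Proof.
apply/eqP; rewrite eqn_leq aut_dist_le; last exact: aut_adj.
have [f gK fK] := aut_bij g; rewrite -{1}(gK x) -{1}(gK y) aut_dist_le// => u v.
by rewrite -(aut_adj g) !fK.
Qed.

Lemma aut_end_class (w : tree_end T) :
  exists2 r, geodesic_ray r & [set g \o s | s in end_rays w] =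
    [set s | geodesic_ray s /\ ray_equiv r s].
Proof.
have [r wr] := end_ex w; have [f gK fK] := aut_bij g.
have gr s : w s -> geodesic_ray (g \o s).
  by move=> ws i j ij; rewrite /= aut_dist (end_ray ws).
exists (g \o r); first exact: gr.
apply/seteqP; split => [_ [s ws <-]|s [ss [m [n rs]]]].
  split; first exact: gr.
  by have [m [n rs]] := end_equiv wr ws; exists m, n => k; rewrite /= rs.
exists (f \o s); last by apply/funext => i /=; rewrite fK.
apply: (end_mem wr).
  by move=> i j ij /=; rewrite -aut_dist !fK ss.
by exists m, n => k /=; rewrite -rs /= gK.
Qed.

Definition aut_end (w : tree_end T) : tree_end T := TreeEnd (aut_end_class w).

Lemma aut_edge_adj (e : edge T) :
  exists u v, adj u v /\ g @` endpoints e = [set u; v].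
Proof.
have [u [v [uv ->]]] := edge_adj e; exists (g u), (g v).
by rewrite aut_adj image_setU !image_set1.
Qed.

Definition aut_edge (e : edge T) : edge T := Edge (aut_edge_adj e).

Lemma aut_far_along v w (P : T -> Prop) :
  far_along (g v) (aut_end w) P <-> far_along v w (P \o g).
Proof.
have [r wr] := end_ex w; have gw : aut_end w (g \o r) by exists r.
by rewrite -(far_alongP _ _ wr) -(far_alongP _ _ gw).
Qed.

Lemma aut_vertex_index v v0 w :
  vertex_index (g v) (g v0) (aut_end w) = vertex_index v v0 w.
Proof.
apply/esym/is_vertex_index_unique/aut_far_along.
by have [N nP] := vertex_indexP v v0 w; exists N => k /nP /=; rewrite !aut_dist.
Qed.

Lemma aut_closer w u v : closer w u v -> closer (aut_end w) (g u) (g v).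
Proof.
by move=> [N uv]; apply/aut_far_along; exists N => k /uv /=; rewrite !aut_dist.
Qed.

Lemma aut_near e w : near_end (aut_edge e) (aut_end w) = g (near_end e w).
Proof.
apply/esym/is_near_unique; have [eu nu] := near_endP e w.
split; first by exists (near_end e w).
move=> _ [v ev <-] vu; apply/aut_closer/nu => // vE; by rewrite vE in vu.
Qed.

Lemma aut_edge_index e e0 w :
  edge_index (aut_edge e) (aut_edge e0) (aut_end w) = edge_index e e0 w.
Proof. by rewrite /edge_index !aut_near aut_vertex_index. Qed.

Lemma aut_edge_surj e : exists e', aut_edge e' = e.
Proof.
have [u [v [uv eE]]] := edge_adj e; have [f gK fK] := aut_bij g.
have fuv : adj (f u) (f v) by rewrite -(aut_adj g) !fK.
exists (@Edge T [set f u; f v] (ex_intro _ _ (ex_intro _ _ (conj fuv erefl)))).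
by apply: edge_eq; rewrite /= image_setU !image_set1 !fK eE.
Qed.

Lemma image_tangent X (h : X -> X -> tree_end T -> int) (a : X -> X) w A :
    (forall x, exists y, a y = x) ->
    (forall x x0, h (a x) (a x0) (aut_end w) = h x x0 w) ->
  tangent_horospheres h w A -> tangent_horospheres h (aut_end w) (a @` A).
Proof.
move=> asurj ah [x0 [n ->]]; exists (a x0), n.
apply/seteqP; split => [_ [x <- <-]|x]; first by rewrite /horo_level /= ah.
by have [y <-] := asurj x; rewrite /horo_level /= ah => <-; exists y.
Qed.

Lemma aut_vertex_tangent (H : vertex_horosphere T) :
  tangent_horospheres (@vertex_index T) (aut_end (tangency H)) (g @` horo_points H).
Proof.
apply: image_tangent (horo_tangent H) => [x|x x0]; last exact: aut_vertex_index.
by have [f _ fK] := aut_bij g; exists (f x).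
Qed.

Lemma aut_edge_tangent (H : edge_horosphere T) :
  tangent_horospheres (@edge_index T) (aut_end (tangency H))
    (aut_edge @` horo_points H).
Proof.
apply: image_tangent (horo_tangent H); first exact: aut_edge_surj.
by move=> e e0; exact: aut_edge_index.
Qed.

Definition aut_vertex_horo (H : vertex_horosphere T) : vertex_horosphere T :=
  Horosphere (aut_vertex_tangent H).

Definition aut_edge_horo (H : edge_horosphere T) : edge_horosphere T :=
  Horosphere (aut_edge_tangent H).

End AutAction.

Definition homeomorphism (X Y : topologicalType) (f : X -> Y) :=
  continuous f /\
  exists g : Y -> X, [/\ continuous g, cancel f g & cancel g f].

Definition Zbundle_isomorphism (P Q B C : topologicalType)
    (piP : P -> B) (piQ : Q -> C) (actP : int -> P -> P) (actQ : int -> Q -> Q)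
    (F : P -> Q) :=
  [/\ homeomorphism F,
      forall k x, F (actP k x) = actQ k (F x) &
      exists2 f : B -> C, homeomorphism f & forall x, piQ (F x) = f (piP x)].

(* Main.v *)
(** If [v] is adjacent to [u] and closer to an end, then [v] is the second vertex
    of the ray from [u]; hence "edge toward the end" and "far endpoint" are
    mutually inverse.  Passing from [v] to the near endpoint of its edge raises
    the index by one, so the index of vertices and that of edges correspond, and
    horospheres go to horospheres.  In the charts at [v0] and [e0] the resulting
    map is [(w, n) |-> (w, n + c w)], where [c w] is the index of the edge from
    [v0] toward [w] relative to [e0]; it is a homeomorphism because [c] is
    locally constant, which reduces by the cocycle identity to the index of two
    adjacent vertices, constant on each of the two open arcs cut out by the
    edge.  Homogeneity with [q >= 1] makes every level nonempty, so the chart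
    coordinate of a horosphere is well defined. *)
Require Import Defs.
From HB Require Import structures.
From mathcomp Require Import all_boot all_order all_algebra.
From mathcomp Require Import all_classical topology.
From mathcomp Require Import zify.

Set Implicit Arguments.
Unset Strict Implicit.
Unset Printing Implicit Defensive.

Import GRing.Theory.

Local Open Scope classical_set_scope.

(** * Edges pointing toward an end, and the shift of index between vertices and edges *)

Section TowardAnEnd.
Variable T : tree.
Implicit Types (u v x : T) (e : edge T) (w : tree_end T).

(** Rays of one end share a tail, so the base vertex is immaterial. *)
Lemma far_along_base u v w (P : T -> Prop) : far_along u w P -> far_along v w P.
Proof. exact: (far_alongP v P (ray_from_in u w)).1. Qed.

Lemma far_along2 v w (P Q R : T -> Prop) : (forall x, P x -> Q x -> R x) ->
  far_along v w P -> far_along v w Q -> far_along v w R.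
Proof.
move=> PQR [N NP] [M MQ]; exists (maxn N M) => k; rewrite geq_max => /andP[Nk Mk].
by apply: PQR; [exact: NP | exact: MQ].
Qed.

Lemma next_vertexE r v w : w r -> r 0 = v -> next_vertex v w = r 1.
Proof. by move=> wr r0; rewrite /next_vertex -(ray_from_unique wr r0). Qed.

Lemma dist_next_vertex v w :
  far_along v w (fun x => dist v x = (dist (next_vertex v w) x).+1).
Proof.
have rr := end_ray (ray_from_in v w); exists 1 => k k1.
have := rr 1 k k1; have := rr 0 k (leq0n k); rewrite ray_from0 => -> ->; lia.
Qed.

Lemma closer_next_vertex v w : closer w (next_vertex v w) v.
Proof.
apply: (@far_along_base v); have [N nP] := dist_next_vertex v w.
by exists N => k /nP ->.
Qed.

Lemma next_vertex_closer u v w : adj u v -> closer w v u -> next_vertex u w = v.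
Proof.
move=> auv [N vu]; have wr := ray_from_in v w; have rr := end_ray wr.
(* The ray from [v] with [u] put in front; it suffices that [s] is geodesic, since rays to an end
   are unique. *)
pose s i := if i is k.+1 then ray_from v w k else u.
have sa i : adj (s i) (s i.+1).
  by case: i => [|i] /=; [rewrite ray_from0 | exact: ray_adj].
(* Closeness gives more than [j.-1], the triangle inequality at most [j]; [adj_seq_ray] needs this
   only for large [j]. *)
have sN j : N.+1 <= j -> dist (s 0) (s j) = j.
  case: j => // j Nj /=; have := vu j Nj; have := rr 0 j (leq0n j).
  have := dist_tri v u (ray_from v w j); rewrite ray_from0 (adj_dist auv); lia.
have ws : w s.
  apply: (end_mem wr); first exact: adj_seq_ray sa sN.
  by exists 0, 1.
by rewrite (next_vertexE ws) //= ray_from0.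
Qed.

Lemma edge_toward_far w : cancel (edge_toward w) (fun e => far_end e w).
Proof.
move=> v; have [+ far] := far_endP (edge_toward w v) w; case=> //= vE.
(* If [next_vertex v w] were the far endpoint, each endpoint would be closer than the other. *)
case: (@closer_asym _ w v (next_vertex v w)); last exact: closer_next_vertex.
rewrite -vE; apply: far => [|vE']; first by left.
by have := next_vertex_adj v w; rewrite -vE -vE' adj_irr.
Qed.

Lemma near_end_toward w v : near_end (edge_toward w v) w = next_vertex v w.
Proof.
apply/esym/is_near_unique; split; first by right.
by move=> x [] -> // _; exact: closer_next_vertex.
Qed.

(** The other endpoint of [e] is closer to the end, hence is the next vertex after the far one. *)
Lemma far_end_toward w : cancel (fun e => far_end e w) (edge_toward w).
Proof.
move=> e; have [ef far] := far_endP e w; have [u [v [auv eE]]] := edge_adj e.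
apply: edge_eq => /=; move: (far_end e w) ef far => f.
have nuv : u <> v by move=> uv; rewrite uv adj_irr in auv.
rewrite eE => -[] -> far.
  by rewrite (@next_vertex_closer u v) //; apply: far; [right | exact/nesym].
by rewrite (@next_vertex_closer v u) 1?adj_sym 1?setUC //; apply: far => //; left.
Qed.

Lemma edge_toward_inj w : injective (edge_toward w).
Proof. exact: can_inj (edge_toward_far w). Qed.

Local Open Scope ring_scope.

(** Read at a common vertex [y] far along, the terms [dist v y] cancel. *)
Lemma vertex_index_cocycle x v u w :
  vertex_index x u w = vertex_index x v w + vertex_index v u w.
Proof.
apply/esym/is_vertex_index_unique.
have xv := far_along_base u (vertex_indexP x v w).
by apply: far_along2 xv (vertex_indexP v u w) => y -> ->; rewrite addrC subrKA.
Qed.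

Lemma vertex_indexxx v w : vertex_index v v w = 0.
Proof. by have := vertex_index_cocycle v v v w; lia. Qed.

Lemma vertex_indexC u v w : vertex_index u v w = - vertex_index v u w.
Proof. by have := vertex_index_cocycle u v u w; rewrite vertex_indexxx; lia. Qed.

Lemma vertex_index_next v w : vertex_index (next_vertex v w) v w = 1.
Proof.
apply/esym/is_vertex_index_unique; have [N nP] := dist_next_vertex v w.
by exists N => k /nP ->; lia.
Qed.

Lemma edge_index_cocycle e e1 e0 w :
  edge_index e e0 w = edge_index e e1 w + edge_index e1 e0 w.
Proof. exact: vertex_index_cocycle. Qed.

(** Both near endpoints lie one level above [v] and [v0], and the two shifts cancel. *)
Lemma edge_index_toward v v0 w :
  edge_index (edge_toward w v) (edge_toward w v0) w = vertex_index v v0 w.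
Proof.
rewrite /edge_index !near_end_toward (vertex_index_cocycle _ v).
rewrite (vertex_index_cocycle v v0) (vertex_indexC v0) !vertex_index_next.
by rewrite addrC addrK.
Qed.

Lemma edge_toward_level v0 w n :
  edge_toward w @` horo_level (@vertex_index T) v0 w n =
  horo_level (@edge_index T) (edge_toward w v0) w n.
Proof.
apply/seteqP; split=> [_ [v <- <-]|e <-]; first exact: edge_index_toward.
by exists (far_end e w); rewrite /horo_level /= -?edge_index_toward far_end_toward.
Qed.

Lemma edge_toward_tangent w A : tangent_horospheres (@vertex_index T) w A ->
  tangent_horospheres (@edge_index T) w (edge_toward w @` A).
Proof. by case=> v0 [n ->]; exists (edge_toward w v0), n; exact: edge_toward_level. Qed.

Lemma edge_toward_preimage_tangent w B : tangent_horospheres (@edge_index T) w B ->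
  tangent_horospheres (@vertex_index T) w (edge_toward w @^-1` B).
Proof.
case=> e0 [n ->]; exists (far_end e0 w), n.
by apply/seteqP; split=> v;
  rewrite /horo_level /= -[in edge_index _ e0](far_end_toward w e0) edge_index_toward.
Qed.

Lemma edge_toward_preimageK w (A : set T) :
  edge_toward w @^-1` (edge_toward w @` A) = A.
Proof.
apply/seteqP; split=> [v [u Au /edge_toward_inj <-] //|v Av]; by exists v.
Qed.

Lemma edge_toward_imageK w (B : set (edge T)) :
  edge_toward w @` (edge_toward w @^-1` B) = B.
Proof.
apply/seteqP; split=> [_ [v Bv <-] //|e Be].
by exists (far_end e w); rewrite /= far_end_toward.
Qed.

Lemma edge_toward_tangent_bij w :
  set_bij (tangent_horospheres (@vertex_index T) w)
          (tangent_horospheres (@edge_index T) w)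
          (fun A => edge_toward w @` A).
Proof.
split=> [A|A B _ _ AB|B tB]; first exact: edge_toward_tangent.
  by rewrite -(edge_toward_preimageK w A) AB edge_toward_preimageK.
exists (edge_toward w @^-1` B); first exact: edge_toward_preimage_tangent.
exact: edge_toward_imageK.
Qed.

End TowardAnEnd.

(** * Local constancy of the indices as functions of the end *)

Section LocallyConstantIndex.
Variable T : tree.
Implicit Types (u v x : T) (e : edge T) (w : tree_end T).

Lemma open_end_arc u v : u <> v -> open (end_arc u v).
Proof.
move=> uv; exists [set end_arc u v]; last by rewrite bigcup_set1.
by move=> _ ->; apply: finI_from1; exists u, v.
Qed.

Lemma adj_end_arcP u v w : adj u v -> end_arc u v w <-> next_vertex u w = v.
Proof.
move=> auv; split=> [[k _ kv]|<-]; last by exists 1%N.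
(* The position [k] of [v] on the ray from [u] is [dist u v], that is 1. *)
have := end_ray (ray_from_in u w) (leq0n k).
rewrite ray_from0 kv (adj_dist auv) => k1.
by rewrite /next_vertex -kv; congr ray_from; lia.
Qed.

Local Open Scope ring_scope.

(** The open arc [end_arc u v] contains [w], and the index equals 1 throughout it. *)
Lemma near_vertex_index_next u v w : adj u v -> next_vertex u w = v ->
  \forall w' \near w, vertex_index v u w' = vertex_index v u w.
Proof.
move=> auv nw; have uv : u <> v by move=> uvE; rewrite uvE adj_irr in auv.
have := open_nbhs_nbhs (conj (open_end_arc uv) ((adj_end_arcP w auv).2 nw)).
apply: filterS => w' /(adj_end_arcP w' auv) nw'.
by rewrite -{1}nw' -nw !vertex_index_next.
Qed.

(* The two open arcs [end_arc u v] and [end_arc v u] of an edge [u v] partition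
   the set of ends, and the index is constant on each of them. *)
Lemma near_vertex_index_adj u v w : adj u v ->
  \forall w' \near w, vertex_index v u w' = vertex_index v u w.
Proof.
move=> auv; have avu : adj v u by rewrite adj_sym.
case: (adj_closer w auv) => [/(next_vertex_closer avu)|/(next_vertex_closer auv)] nw.
  apply: filterS (near_vertex_index_next avu nw) => w' E.
  by rewrite vertex_indexC E -vertex_indexC.
exact: near_vertex_index_next.
Qed.

(** Induction along a path from [u] to [v]: the cocycle identity writes the index as a sum over
    adjacent pairs. *)
Lemma near_vertex_index u v w :
  \forall w' \near w, vertex_index v u w' = vertex_index v u w.
Proof.
have [p + <-] := tree_connected u v; elim: p u => [|x p IH] u /=.
  by move=> _; apply: filterE => w'; rewrite !vertex_indexxx.
move=> /andP[/near_vertex_index_adj ux /IH xp].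
apply: filterS2 (ux w) xp => w' E1 E2.
by rewrite !(vertex_index_cocycle (last x p) x u) E1 E2.
Qed.

(** The near endpoint is one level above the other. The maximum removes [near_end e w], which varies
    with [w], leaving only indices of fixed vertices. *)
Lemma near_end_index_max u v e v0 w : endpoints e = [set u; v] -> adj u v ->
  vertex_index (near_end e w) v0 w =
  Num.max (vertex_index u v0 w) (vertex_index v v0 w).
Proof.
move=> eE auv; have avu : adj v u by rewrite adj_sym.
case: (adj_closer w auv) => c.
  have := vertex_index_next v w; rewrite (next_vertex_closer avu c) => uv.
  have -> : near_end e w = u.
    by apply/esym/is_near_unique; split=> [|x]; rewrite eE; [left | case=> ->].
  by have := vertex_index_cocycle u v v0 w; lia.
have := vertex_index_next u w; rewrite (next_vertex_closer auv c) => vu.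
have -> : near_end e w = v.
  by apply/esym/is_near_unique; split=> [|x]; rewrite eE; [right | case=> ->].
by have := vertex_index_cocycle v u v0 w; lia.
Qed.

Lemma near_edge_index_toward v0 e0 w : \forall w' \near w,
  edge_index (edge_toward w' v0) e0 w' = edge_index (edge_toward w v0) e0 w.
Proof.
have [a [b [ab eE]]] := edge_adj e0.
(* The 1 is the rise from [v0] to its next vertex; the maximum is the level of the near endpoint of
   [e0]. *)
have E w' : edge_index (edge_toward w' v0) e0 w' =
    1 - Num.max (vertex_index a v0 w') (vertex_index b v0 w').
  rewrite /edge_index near_end_toward (vertex_index_cocycle _ v0) vertex_index_next.
  by rewrite vertex_indexC (near_end_index_max _ _ eE ab).
apply: filterS2 (near_vertex_index v0 a w) (near_vertex_index v0 b w) => w' aE bE.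
by rewrite !E aE bE.
Qed.

End LocallyConstantIndex.

(** * Every level of the index is inhabited *)

Section Levels.
Local Open Scope ring_scope.

(** From any vertex one can go one level up, and also one level down; induction on the integer [n]
    then starts from [v0] at level 0. *)
Lemma vertex_level_neq0 (q : nat) (T : tree) (v0 : T) w n : (1 <= q)%N ->
  homogeneous q T -> exists v, vertex_index v v0 w = n.
Proof.
move=> q1 hT.
have up v : exists v', vertex_index v' v w = 1.
  by exists (next_vertex v w); exact: vertex_index_next.
have down v : exists v', vertex_index v' v w = -1.
  have /card_set_bijP[f [_ _ fsurj]] := hT v.
  (* As [1 <= q], both 0 and 1 lie in [I_q.+1], so [v] has two distinct neighbours; at least one of
     them is not the next vertex, and it lies one level below. *)
  have [u0 av0 f0] := fsurj 0%N isT; have [u1 av1 f1] := fsurj 1%N q1.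
  have [u avu nu] : exists2 u, adj v u & next_vertex v w <> u.
    have [nu0|nu0] := pselect (next_vertex v w = u0); last by exists u0.
    by exists u1 => //; rewrite nu0 => u01; rewrite u01 f1 in f0.
  exists u; have auv : adj u v by rewrite adj_sym.
  case: (adj_closer w avu) => [/(next_vertex_closer auv) uv|].
    by rewrite vertex_indexC -{1}uv vertex_index_next.
  by move/(next_vertex_closer avu).
elim: n => [|n [v vn]|n [v vn]]; first by exists v0; exact: vertex_indexxx.
  have [v' v'v] := up v; exists v'.
  by rewrite (vertex_index_cocycle _ v) v'v vn; lia.
have [v' v'v] := down v; exists v'.
by rewrite (vertex_index_cocycle _ v) v'v vn; lia.
Qed.

Lemma edge_level_neq0 (q : nat) (T : tree) (e0 : edge T) w n : (1 <= q)%N ->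
  homogeneous q T -> exists e, edge_index e e0 w = n.
Proof.
move=> q1 hT; have [v vn] := vertex_level_neq0 (far_end e0 w) w n q1 hT.
by exists (edge_toward w v); rewrite -[e0 in LHS](far_end_toward w) edge_index_toward.
Qed.

End Levels.

(** * Charts of horospheres, for any cocycle with inhabited levels *)

Section Charts.
Local Open Scope ring_scope.
Variables (T : tree) (X : Type) (h : X -> X -> tree_end T -> int).
Hypothesis h_cocycle : forall x y z w, h x z w = h x y w + h y z w.
Hypothesis h_level : forall x0 w n, exists x, h x x0 w = n.

Lemma horo_level_rebase x0 x1 w n :
  horo_level h x1 w n = horo_level h x0 w (n + h x1 x0 w).
Proof.
apply/seteqP; split=> x; rewrite /horo_level /= (h_cocycle x x1 x0).
  by move=> ->.
exact: addIr.
Qed.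

(** An inhabited level determines its value. *)
Lemma horo_level_inj x0 w : injective (horo_level h x0 w).
Proof.
move=> m n E; have [x xm] := h_level x0 w m.
by have : horo_level h x0 w m x by []; rewrite E /horo_level /= xm.
Qed.

(** Rebasing to [x0] the level that defines [H] supplies a witness, so [xget] returns a genuine
    index and not merely its default. *)
Lemma horo_indexP x0 (H : horosphere h) :
  horo_points H = horo_level h x0 (tangency H) (horo_index x0 H).
Proof.
apply: (@xgetPex _ 0 [set n | horo_points H = horo_level h x0 (tangency H) n]).
by have [x1 [n ->]] := horo_tangent H; eexists; exact: horo_level_rebase.
Qed.

Lemma horo_index_unique x0 (H : horosphere h) n :
  horo_points H = horo_level h x0 (tangency H) n -> horo_index x0 H = n.
Proof. by rewrite (horo_indexP x0 H) => /horo_level_inj. Qed.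

End Charts.

(** The second factor is discrete and [c] locally constant, so the second coordinate of the image is
    locally constant. *)
Lemma continuous_shear (B : topologicalType) (c : B -> int) :
    (forall b, \forall b' \near b, c b' = c b) ->
  continuous (fun p : B * discrete_topology int =>
    (p.1, (p.2 : int) + c p.1)%R : B * discrete_topology int).
Proof.
move=> c_lc [b n]; apply: (@cvg_pair _ _ _ (nbhs (b, n)) (nbhs b)
  (nbhs ((n : int) + c b : discrete_topology int)%R)); first exact: cvg_fst.
move=> A /nbhs_singleton /= Anb.
(* On this product neighbourhood the sum is constantly [n + c b]. *)
exists ([set b' | c b' = c b], [set n]) => /=.
  by split; [exact: c_lc | apply: open_nbhs_nbhs; split => //; exact: discrete_open].
by move=> [b' n'] /= [-> ->].
Qed.

Lemma homeomorphism_id (B : topologicalType) : homeomorphism (@id B).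
Proof.
have idc : continuous (@id B) by move=> b; exact: cvg_id.
by split=> //; exists id.
Qed.

(** * The bijection of horospheres, its equivariance and its form in charts *)

Section HorosphereMap.
Variable T : tree.

Definition edge_horo_of_vertex (H : vertex_horosphere T) : edge_horosphere T :=
  Horosphere (edge_toward_tangent (horo_tangent H)).

Definition vertex_horo_of_edge (K : edge_horosphere T) : vertex_horosphere T :=
  Horosphere (edge_toward_preimage_tangent (horo_tangent K)).

Lemma edge_horo_of_vertexK : cancel edge_horo_of_vertex vertex_horo_of_edge.
Proof. by move=> H; apply: horosphere_eq => //=; exact: edge_toward_preimageK. Qed.

Lemma vertex_horo_of_edgeK : cancel vertex_horo_of_edge edge_horo_of_vertex.
Proof. by move=> K; apply: horosphere_eq => //=; exact: edge_toward_imageK. Qed.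

(** The image under [g] of the ray from [v] is the ray from [g v] to the image end. Equivariance of
    the horosphere map rests on this. *)
Lemma aut_next_vertex (g : tree_aut T) (v : T) w :
  next_vertex (g v) (aut_end g w) = g (next_vertex v w).
Proof.
have gw : aut_end g w (g \o ray_from v w).
  by exists (ray_from v w) => //; exact: ray_from_in.
by rewrite (next_vertexE gw) //= ray_from0.
Qed.

Lemma aut_edge_toward (g : tree_aut T) w (v : T) :
  aut_edge g (edge_toward w v) = edge_toward (aut_end g w) (g v).
Proof.
by apply: edge_eq; rewrite /= image_setU !image_set1 aut_next_vertex.
Qed.

Lemma aut_edge_horo_of_vertex (g : tree_aut T) (H : vertex_horosphere T) :
  edge_horo_of_vertex (aut_vertex_horo g H) =
  aut_edge_horo g (edge_horo_of_vertex H).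
Proof.
apply: horosphere_eq => //=.
apply/seteqP; split=> [_ [_ [v Hv <-] <-]|_ [_ [v Hv <-] <-]].
  by rewrite -aut_edge_toward; exists (edge_toward (tangency H) v) => //; exists v.
by rewrite aut_edge_toward; exists (g v) => //; exists v.
Qed.

Local Open Scope ring_scope.
Variable q : nat.
Hypotheses (q_gt0 : (1 <= q)%N) (hT : homogeneous q T).

Let elevel (e0 : edge T) w n := edge_level_neq0 e0 w n q_gt0 hT.

(** The image has the same index relative to the edge from [v0] toward the end; passing from that
    reference edge to [e0] adds the second term. *)
Lemma horo_index_edge_of_vertex (v0 : T) (e0 : edge T) (H : vertex_horosphere T) :
  horo_index e0 (edge_horo_of_vertex H) =
  horo_index v0 H + edge_index (edge_toward (tangency H) v0) e0 (tangency H).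
Proof.
apply: (horo_index_unique (@edge_index_cocycle T) elevel) => /=.
rewrite (horo_indexP (@vertex_index_cocycle T) v0 H) edge_toward_level.
exact: horo_level_rebase (@edge_index_cocycle T) _ _ _ _.
Qed.

(** The offset between the charts depends on the tangency point alone, so it commutes with adding
    [k]. *)
Lemma edge_horo_of_vertex_shift (v0 : T) (e0 : edge T) k (H : vertex_horosphere T) :
  edge_horo_of_vertex (horo_shift v0 k H) =
  horo_shift e0 k (edge_horo_of_vertex H).
Proof.
apply: horosphere_eq => //=.
rewrite edge_toward_level (horo_index_edge_of_vertex v0) addrAC.
exact: horo_level_rebase (@edge_index_cocycle T) _ _ _ _.
Qed.

Lemma edge_horo_of_vertex_homeomorphism (v0 : T) (e0 : edge T) :
  @homeomorphism (horo_space (@vertex_index T) v0)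
    (horo_space (@edge_index T) e0) edge_horo_of_vertex.
Proof.
pose c w := edge_index (edge_toward w v0) e0 w.
have c_lc w : \forall w' \near w, c w' = c w by exact: near_edge_index_toward.
split.
  (* Continuity into an initial topology is tested after the chart, where the map becomes the shear
     by [c]. *)
  apply: continuous_comp_initial.
  have -> : @horo_chart T _ (@edge_index T) e0 \o edge_horo_of_vertex =
      (fun p : tree_end T * discrete_topology int =>
        (p.1, (p.2 : int) + c p.1) : tree_end T * discrete_topology int) \o
      @horo_chart T _ (@vertex_index T) v0.
    by apply/funext => H; rewrite /horo_chart /= (horo_index_edge_of_vertex v0).
  move=> H; apply: continuous_comp; first exact: initial_continuous.
  exact: continuous_shear.
exists vertex_horo_of_edge; split; last exact: vertex_horo_of_edgeK.
  apply: continuous_comp_initial.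
  (* In charts the inverse is the shear by [- c]. *)
  have -> : @horo_chart T _ (@vertex_index T) v0 \o vertex_horo_of_edge =
      (fun p : tree_end T * discrete_topology int =>
        (p.1, (p.2 : int) + - c p.1) : tree_end T * discrete_topology int) \o
      @horo_chart T _ (@edge_index T) e0.
    apply/funext => K; rewrite /horo_chart /=; congr pair.
    have := horo_index_edge_of_vertex v0 e0 (vertex_horo_of_edge K).
    by rewrite vertex_horo_of_edgeK => ->; rewrite addrK.
  move=> K; apply: continuous_comp; first exact: initial_continuous.
  apply: (@continuous_shear _ (fun w => - c w)) => w.
  by apply: filterS (c_lc w) => w' ->.
exact: edge_horo_of_vertexK.
Qed.

End HorosphereMap.

Theorem proposition1p3p25 (q : nat) (T : tree) :
  1 <= q -> homogeneous q T ->
  (forall omega : tree_end T,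
     [/\ injective (edge_toward omega),
         cancel (edge_toward omega) (fun e => far_end e omega),
         cancel (fun e => far_end e omega) (edge_toward omega) &
         set_bij (tangent_horospheres (@vertex_index T) omega)
                 (tangent_horospheres (@edge_index T) omega)
                 (fun A => edge_toward omega @` A)]) /\
  exists Xi : vertex_horosphere T -> edge_horosphere T,
    [/\ forall H, tangency (Xi H) = tangency H /\
          horo_points (Xi H) = edge_toward (tangency H) @` horo_points H,
        bijective Xi,
        forall (g : tree_aut T) (H : vertex_horosphere T),
          Xi (aut_vertex_horo g H) = aut_edge_horo g (Xi H) &
        forall (v0 : T) (e0 : edge T),
          @Zbundle_isomorphism
            (horo_space (@vertex_index T) v0) (horo_space (@edge_index T) e0)
            (tree_end T) (tree_end T)
            (@tangency T T (@vertex_index T))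
            (@tangency T (edge T) (@edge_index T))
            (@horo_shift T T (@vertex_index T) v0)
            (@horo_shift T (edge T) (@edge_index T) e0)
            Xi].
Proof.
move=> q1 hT; split=> [w|].
  split; [exact: edge_toward_inj | exact: edge_toward_far |
    exact: far_end_toward | exact: edge_toward_tangent_bij].
exists (@edge_horo_of_vertex T); split=> //.
- by exists (@vertex_horo_of_edge T);
    [exact: edge_horo_of_vertexK | exact: vertex_horo_of_edgeK].
- exact: aut_edge_horo_of_vertex.
move=> v0 e0; split.
- exact: edge_horo_of_vertex_homeomorphism hT _ _.
- by move=> k H; exact: edge_horo_of_vertex_shift hT _ _ _ _.
(* Tangency points are preserved, so the map covers the identity of the ends. *)
- by exists id; [exact: homeomorphism_id|].
Qed.
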